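(* Let $L>0$ and $T>0$. The operators $\tfrac12\mathsf{Id}+\mathsf{K}$ and $-\tfrac12\mathsf{Id}+\mathsf{K}$, each regarded as a map $H^{1/2}_{0,}(\Sigma)\to H^{1/2}_{0,}(\Sigma)$, are continuous and isomorphisms.
   Context: Here $\Gamma=\{0,L\}$ and $\Sigma=\Gamma\times[0,T]$. A function on $\Sigma$ is a pair $v=(v_0,v_L)=(v(0,\cdot),v(L,\cdot))$ of functions on $(0,T)$; $L^2(\Sigma)=L^2(0,T)\times L^2(0,T)$. The space $$H^1_{0,}(\Sigma)=\{v=(v_0,v_L): v_0,v_L\in H^1(0,T),\ v_0(0)=v_L(0)=0\}$$ has norm $\|v\|_{H^1_{0,}(\Sigma)}=\|\partial_t v\|_{L^2(\Sigma)}$, and $H^{1/2}_{0,}(\Sigma):=[H^1_{0,}(\Sigma),L^2(\Sigma)]_{1/2}$ is the (Hilbert) interpolation space. $\mathsf{Id}$ is the identity. $\mathsf{K}$ is the double layer boundary integral operator of the one-dimensional wave equation, given explicitly by $$\mathsf{K}v(0,t)=-\tfrac12 v(L,t-L),\qquad \mathsf{K}v(L,t)=-\tfrac12 v(0,t-L),$$ where functions on $\Sigma$ are extended by zero to times $t\le 0$. ''Isomorphism'' means bounded linear bijection with bounded inverse. *)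

(* Defs.v *)
From HB Require Import structures.
From mathcomp Require Import all_boot all_order all_algebra.
From mathcomp Require Import all_classical all_reals all_analysis.
From mathcomp Require Import measurable_realfun.

Set Implicit Arguments.
Unset Strict Implicit.
Unset Printing Implicit Defensive.
Import Order.TTheory GRing.Theory Num.Theory.
Import numFieldNormedType.Exports.

Local Open Scope classical_set_scope.
Local Open Scope ring_scope.
Local Open Scope quotient_scope.

Section L2_interval.
Context {R : realType}.
Variable T : R.

Definition leb0T : {measure set (measurableTypeR R) -> \bar R} :=
  mrestr (@lebesgue_measure R) (measurable_itv `]0, T[).

Definition L2fun := LfunType leb0T (lee1n 2).

(* L2fun is a space of functions; L2 is its quotient by the functions
   vanishing almost everywhere on ]0, T[. *)
Definition ae0 : {pred L2fun} :=
  fun f => `[< (f : measurableTypeR R -> R) = cst 0 %[ae leb0T] >].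

Lemma ae0_zmod_closed : zmod_closed ae0.
Proof.
split; first by rewrite unfold_in; apply/asboolP/aeW.
move=> f g; rewrite !unfold_in => /asboolP f0 /asboolP g0; apply/asboolP.
have := ae_eq_sub f0 g0.
by apply: (@filterS _ _ (ae_filter_ringOfSetsType leb0T)) => x; rewrite /= subr0.
Qed.
HB.instance Definition _ := GRing.isZmodClosed.Build L2fun ae0 ae0_zmod_closed.

Definition L2 : Type := {ideal_quot ae0}.
HB.instance Definition _ := GRing.Zmodule.on L2.
HB.instance Definition _ := EqQuotient.on L2.

Lemma L2_eqP (f g : L2fun) :
  \pi_L2 f = \pi_L2 g <-> (f : measurableTypeR R -> R) = g %[ae leb0T].
Proof.
have -> : (\pi_L2 f = \pi_L2 g) = (f - g \in ae0).
  by rewrite Quotient.idealrBE; apply/propext; split => [h|/eqP//]; exact/eqP.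
rewrite unfold_in; split => [/asboolP|] fg.
  apply: (@filterS _ _ (ae_filter_ringOfSetsType leb0T)) fg => x h xT.
  by apply/eqP; rewrite -subr_eq0; apply/eqP; exact: h.
apply/asboolP; apply: (@filterS _ _ (ae_filter_ringOfSetsType leb0T)) fg => x h xT.
by apply/eqP; rewrite subr_eq0; apply/eqP; exact: h.
Qed.

Definition L2scale (a : R) (u : L2) : L2 := \pi_L2 (a *: repr u).

Lemma L2scale_pi (a : R) (f : L2fun) : L2scale a (\pi_L2 f) = \pi_L2 (a *: f).
Proof.
apply/L2_eqP.
have /L2_eqP : \pi_L2 (repr (\pi_L2 f)) = \pi_L2 f by rewrite reprK.
apply: (@filterS _ _ (ae_filter_ringOfSetsType leb0T)) => x h xT.
by rewrite /=; congr (_ * _); exact: h.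
Qed.

Lemma L2addE (f g : L2fun) : \pi_L2 f + \pi_L2 g = \pi_L2 (f + g).
Proof. by rewrite -(@pi_addr _ _ _ _ _ {ideal_quot ae0}). Qed.

Lemma L2scaleA a b u : L2scale a (L2scale b u) = L2scale (a * b) u.
Proof. by rewrite -[u]reprK (L2scale_pi b) (L2scale_pi a) L2scale_pi scalerA. Qed.
Lemma L2scale1 : left_id 1 L2scale.
Proof. by move=> u; rewrite -[u]reprK L2scale_pi scale1r. Qed.
Lemma L2scaleDr : right_distributive L2scale +%R.
Proof.
move=> a u v; rewrite -[u]reprK -[v]reprK.
by rewrite L2addE !(L2scale_pi a) L2addE scalerDr.
Qed.
Lemma L2scaleDl v : {morph L2scale^~ v : a b / a + b}.
Proof. by move=> a b; rewrite -[v]reprK !L2scale_pi L2addE scalerDl. Qed.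

HB.instance Definition _ := GRing.Zmodule_isLmodule.Build R L2
  L2scaleA L2scale1 L2scaleDr L2scaleDl.

Definition L2norm (u : L2) : R := fine ('N[leb0T]_2%:E[EFin \o repr u])%E.

End L2_interval.

Section translation.
Context {R : realType}.
Local Notation mR := (measurableTypeR R).
Local Notation mu := (@lebesgue_measure R).

Lemma measurable_translate (a : R) :
  measurable_fun [set: mR] ((fun t => t - a) : mR -> mR).
Proof. by apply: measurable_funB. Qed.

Lemma lebesgue_measure_translate (a : R) (A : set mR) : measurable A ->
  pushforward mu ((fun t => t - a) : mR -> mR) A = mu A.
Proof.
move=> mA.
apply/esym/lebesgue_measure_unique => [|//=|//]; first exact: measurable_translate.
move=> mf _ [[x y]] _ <-; rewrite /pushforward /=.
have -> : ((fun t => t - a) : mR -> mR) @^-1` `]x, y] = (`]x + a, y + a])%classic.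
  by apply/seteqP; split => t /=; rewrite !in_itv/= ltrBrDr lerBlDr.
rewrite !lebesgue_measure_itv/= !lte_fin ltrD2r.
by case: ifP => // _; rewrite -!EFinB opprD addrACA subrr addr0.
Qed.

Lemma ge0_integral_leb0T (T : R) (h : mR -> \bar R) :
  measurable_fun [set: mR] h -> (forall t, 0 <= h t)%E ->
  (\int[leb0T T]_t h t = \int[mu]_(t in `]0%R, T[) h t)%E.
Proof.
move=> mh h0; have mD : measurable (`]0, T[ : set mR) by exact: measurable_itv.
rewrite (@ge0_negligible_integral _ _ _ (leb0T T) setT (~` `]0, T[)) //; last 2 first.
- exact: measurableC.
- by rewrite /leb0T /= /mrestr setICl measure0.
rewrite setTD setCK; apply: eq_measure_integral => A mA AD /=.
by rewrite /leb0T /= /mrestr setIidl.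
Qed.

End translation.

Section delay.
Context {R : realType}.
Local Notation mR := (measurableTypeR R).
Variables T a : R.

(* f (t - a), where f is first extended by zero outside ]0, T[; for a > 0 and
   t < T only times t - a <= 0 are affected by this extension. *)
Definition delay_fun (f : mR -> R) (t : mR) : R := (f \_ `]0, T[) (t - a).

Lemma measurable_delay_fun (f : mR -> R) :
  measurable_fun [set: mR] f -> measurable_fun [set: mR] (delay_fun f).
Proof.
move=> mf; apply: (@measurableT_comp _ _ _ _ _ _ (f \_ `]0, T[)); last first.
  exact: measurable_translate.
apply/(@measurable_restrictT _ _ mR _ `]0, T[) => //.
exact: measurable_funS mf.
Qed.

Lemma ge0_integral_delay (f : mR -> R) : measurable_fun [set: mR] f ->
  (\int[leb0T T]_t (`|delay_fun f t| `^ 2)%:E <=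
   \int[leb0T T]_t (`|f t| `^ 2)%:E)%E.
Proof.
have msq (g : mR -> R) : measurable_fun [set: mR] g ->
    measurable_fun [set: mR] (fun t => (`|g t| `^ 2)%:E).
  move=> mg; apply/measurable_EFinP.
  by apply: (measurableT_comp (measurable_powR _)); exact: measurableT_comp.
have sq0 (g : mR -> R) t : (0 <= (`|g t| `^ 2)%:E)%E by rewrite lee_fin powR_ge0.
move=> mf; rewrite (ge0_integral_leb0T T (msq _ mf) (sq0 f)).
rewrite (ge0_integral_leb0T T (msq _ (measurable_delay_fun mf)) (sq0 _)).
set g := fun t : mR => (`|(f \_ `]0, T[) t| `^ 2)%:E.
have mg : measurable_fun [set: mR] g.
  apply: msq; apply/(@measurable_restrictT _ _ mR _ `]0, T[) => //.
  exact: measurable_funS mf.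
have g0 t : (0 <= g t)%E by exact: sq0.
apply: (@le_trans _ _ (\int[lebesgue_measure]_(t in [set: mR]) g (t - a)%R)%E).
  apply: ge0_subset_integral => //.
  by apply: (measurableT_comp mg); exact: measurable_translate.
rewrite [X in (X <= _)%E](_ : _ = \int[lebesgue_measure]_t g t)%E; last first.
  pose tr : mR -> mR := fun t => t - a.
  transitivity (\int[pushforward lebesgue_measure tr]_t g t)%E.
    by rewrite ge0_integral_pushforward//; exact: measurable_translate.
  apply: eq_measure_integral => [|mf' A mA _]; first exact: measurable_translate.
  exact: lebesgue_measure_translate.
rewrite [leRHS]integral_mkcond le_eqVlt; apply/orP; left; apply/eqP.
apply: eq_integral => t _; rewrite /g !patchE.
by case: ifPn => // _; rewrite normr0 powR0.
Qed.

Lemma delay_fun_Lfun (f : L2fun T) : delay_fun f \in Lfun (leb0T T) 2%:E.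
Proof.
have mf : measurable_fun [set: mR] f by [].
rewrite inE; apply/andP; split; rewrite inE/=; first exact: measurable_delay_fun.
rewrite /finite_norm unlock /Lnorm; apply: poweR_lty.
apply: le_lt_trans (ge0_integral_delay mf) _.
have := Lfunction_finite _ f; rewrite /finite_norm unlock /Lnorm /=.
by apply: lty_poweRy; rewrite invr_eq0.
Qed.

Lemma delay_fun_ae (f g : mR -> R) :
  f = g %[ae leb0T T] -> delay_fun f = delay_fun g %[ae leb0T T].
Proof.
have mD : measurable (`]0, T[ : set mR) by exact: measurable_itv.
move=> [N [mN N0 fgN]].
pose tr : mR -> mR := fun t => t - a.
have mtr : measurable (tr @^-1` (N `&` `]0, T[)).
  rewrite -[X in measurable X]setTI.
  by apply: measurable_translate => //; exact: measurableI.
exists (tr @^-1` (N `&` `]0, T[)); split => //.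
- apply/eqP; rewrite -measure_le0 /leb0T /= /mrestr.
  apply: (@le_trans _ _ (lebesgue_measure (tr @^-1` (N `&` `]0, T[)))).
    by apply: le_measure => //; rewrite inE//; exact: measurableI.
  have := @lebesgue_measure_translate R a (N `&` `]0, T[) (measurableI _ _ mN mD).
  by rewrite /pushforward => ->; move: N0; rewrite /leb0T /= /mrestr => ->.
- move=> t /= /not_implyP[_]; rewrite /delay_fun !patchE.
  case: ifPn => //; rewrite inE => tD fg; split => //.
  by apply: fgN => /= /(_ I).
Qed.

Definition delay (u : L2 T) : L2 T :=
  \pi_(L2 T) (Lfun_Sub (lee1n 2) (delay_fun_Lfun (repr u))).

Lemma delay_pi (f : L2fun T) : delay (\pi_(L2 T) f) =
  \pi_(L2 T) (Lfun_Sub (lee1n 2) (delay_fun_Lfun f)).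
Proof.
apply/L2_eqP; apply: delay_fun_ae.
by have /L2_eqP : \pi_(L2 T) (repr (\pi_(L2 T) f)) = \pi_(L2 T) f by rewrite reprK.
Qed.

End delay.

Section Sobolev.
Context {R : realType}.
Variable T : R.

Definition test_function (phi : R -> R) : Prop :=
  [/\ forall t, derivable phi t 1,
      continuous (derive1 phi) &
      exists a b, [/\ 0 < a, b < T & forall t, phi t != 0 -> a <= t <= b]].

(* Test functions are C^1 with compact support in ]0, T[ (Brezis' convention);
   by mollification, smooth ones give the same weak derivatives. *)
Definition is_weak_deriv (u g : L2 T) : Prop :=
  forall phi, test_function phi ->
    \int[leb0T T]_t (repr u t * derive1 phi t) =
    - \int[leb0T T]_t (repr g t * phi t).

Definition H1 : set (L2 T) := [set u | exists g, is_weak_deriv u g].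

Definition weak_deriv (u : L2 T) : L2 T := xget 0 [set g | is_weak_deriv u g].

(* v(0) is the value at 0 of the representative of v continuous on [0, T]. *)
Definition vanishes_at_0 (u : L2 T) : Prop :=
  exists f : measurableTypeR R -> R,
    [/\ {within `[0, T], continuous (f : R -> R)},
        (repr u : measurableTypeR R -> R) = f %[ae leb0T T] & f 0 = 0].

Definition H1_0 : set (L2 T) := H1 `&` vanishes_at_0.

(* The pair (v_0, v_L) stands for a function on {0, L} x [0, T]. *)
Definition L2Sigma : Type := (L2 T * L2 T)%type.

Definition L2Sigma_norm (v : L2Sigma) : R :=
  Num.sqrt (L2norm v.1 ^+ 2 + L2norm v.2 ^+ 2).

Definition H1_0Sigma : set L2Sigma := [set v | H1_0 v.1 /\ H1_0 v.2].

Definition H1_0Sigma_norm (v : L2Sigma) : R :=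
  L2Sigma_norm (weak_deriv v.1, weak_deriv v.2).

End Sobolev.

Section interpolation.
Context {R : realType} {V : lmodType R}.
Variables (X : set V) (normX : V -> R) (Y : set V) (normY : V -> R).

(* The square of K(t, v) = inf_(v = x + y) (|x|_X^2 + t^2 |y|_Y^2)^(1/2). *)
Definition sqrK (t : R) (v : V) : \bar R :=
  ereal_inf [set e | exists x y, [/\ X x, Y y, v = x + y &
    e = (normX x ^+ 2 + t ^+ 2 * normY y ^+ 2)%:E]].

(* Norm of [X, Y]_theta, 0 < theta < 1, by the quadratic K-method (theta = 0 is
   the X end). If X is the domain of a positive self-adjoint operator S of the
   Hilbert space Y and |x|_X = |S x|_Y, the factor 2 sin(pi theta) / pi makes it
   equal to the spectral norm |S^(1 - theta) v|_Y; the value +oo means that v is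
   not in the space. *)
Definition interp_norm (theta : R) (v : V) : \bar R :=
  sqrte ((2 * sin (pi * theta) / pi)%:E *
    \int[lebesgue_measure]_(t in `]0%R, +oo[)
      ((t `^ (- (2 * theta) - 1))%:E * sqrK t v))%E.

Definition interp (theta : R) : set V := [set v | (interp_norm theta v < +oo)%E].

End interpolation.

Section H12.
Context {R : realType}.
Variable T : R.

Definition H12Sigma : set (L2Sigma T) :=
  interp (@H1_0Sigma R T) (@H1_0Sigma_norm R T) setT (@L2Sigma_norm R T) 2^-1.

Definition H12Sigma_norm : L2Sigma T -> \bar R :=
  interp_norm (@H1_0Sigma R T) (@H1_0Sigma_norm R T) setT (@L2Sigma_norm R T) 2^-1.

Definition double_layer (L : R) (v : L2Sigma T) : L2Sigma T :=
  (- 2^-1 *: delay L v.2, - 2^-1 *: delay L v.1).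

End H12.

Section operators.
Context {R : realType} {V : lmodType R}.
Variables (E : set V) (N : V -> \bar R).

(* N is the norm of E, with values +oo outside E. *)
Definition continuous_on (A : V -> V) : Prop :=
  forall v, E v -> forall eps : R, 0 < eps -> exists2 delta : R, 0 < delta &
    forall w, E w -> (N (w - v) < delta%:E)%E -> (N (A w - A v) < eps%:E)%E.

Definition bounded_on (A : V -> V) : Prop :=
  exists C : R, forall v, E v -> (N (A v) <= C%:E * N v)%E.

Definition linear_on (A : V -> V) : Prop :=
  forall a u v, E u -> E v -> A (a *: u + v) = a *: A u + A v.

Definition isomorphism_on (A : V -> V) : Prop :=
  [/\ set_bij E E A, linear_on A, bounded_on A &
      exists2 B : V -> V, {in E, cancel A B} & bounded_on B].

End operators.

(* Main.v *)
Require Import Defs.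
From mathcomp Require Import all_boot all_order all_algebra.
From mathcomp Require Import all_classical all_reals all_analysis.
From mathcomp Require Import measurable_realfun ring lra.
Import Order.TTheory GRing.Theory Num.Theory.
Import numFieldNormedType.Exports.
Local Open Scope classical_set_scope.
Local Open Scope ring_scope.

Set Implicit Arguments.
Unset Strict Implicit.
Unset Printing Implicit Defensive.

(** Up to the factor [-1/2], the double layer operator swaps the two boundary
    components and delays them by [L]. Let [S] be this crossed delay
    ([cross_delay]); then [1/2 + K = 1/2 (1 - S)] and [-1/2 + K = -1/2 (1 + S)].
    A delay by at least [T] annihilates every function on [`]0, T[], so [S] is
    nilpotent ([cross_delay_nilpotent]), both operators are invertible, and their
    inverses are finite Neumann series in [S]. Everything follows as soon as [S] is
    bounded on the interpolation space.

    An operator which is bounded on the two end spaces is bounded on the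
    interpolation space, because it maps decompositions [v = x + y] to
    decompositions ([interp_norm_bounded]). Applied to polynomials in [S], this
    reduces the theorem to the boundedness of [S] on L^2 and on H^1_{0,}
    ([interp_isomorphism_nilpotent]). On L^2 the delay is a contraction, since the
    Lebesgue measure is translation invariant ([L2norm_delay]).

    On H^1_{0,} the point is that the delay commutes with the weak derivative
    ([is_weak_deriv_delay]): the extension by zero to negative times creates no jump
    because the function vanishes at time 0. Concretely, the test function [phi (t + L)]
    is cut off near 0 by a steep ramp, and the term containing the derivative of the
    ramp disappears in the limit. As the norm of H^1_{0,} refers to a chosen weak
    derivative, uniqueness of weak derivatives is also required. It follows from
    the fundamental lemma of the calculus of variations ([L2_eq0]). *)

(** * Interpolation of bounded operators *)

Section interpolation_of_operators.
Context {R : realType} {V : lmodType R}.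

Import HBNNSimple.

(** A nonnegative integral is the supremum of the integrals of the simple
    functions below the integrand; scaling these by [M^-1] compares the two
    sides for arbitrary [f] and [g]. This applies directly to the integrand of
    the K-method, which is an infimum over decompositions. *)
Lemma ge0_le_integral_scale d (T : measurableType d)
    (mu : {measure set T -> \bar R}) (D : set T) (f g : T -> \bar R) (M : R) :
  0 < M -> (forall t, D t -> 0 <= f t)%E -> (forall t, D t -> 0 <= g t)%E ->
  (forall t, D t -> f t <= M%:E * g t)%E ->
  (\int[mu]_(t in D) f t <= M%:E * \int[mu]_(t in D) g t)%E.
Proof.
move=> M0 f0 g0 fg; rewrite !ge0_integralE//.
apply: ge_ereal_sup => _ [h hf <-].
rewrite -lee_pdivrMl//; apply: ereal_sup_ubound.
have M'0 : 0 <= M^-1 by rewrite invr_ge0 ltW.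
exists (scale_nnsfun h M'0).
  move=> x /=; rewrite EFinM lee_pdivrMl//.
  apply: (le_trans (hf x)); rewrite !patchE; case: ifPn => xD.
    by apply: fg; rewrite inE in xD.
  by rewrite mule0.
by rewrite -sintegralrM.
Qed.

(** Squared norms are compared because the K-functional is a sum of squares;
    the stability of [E] is included so that such operators compose. *)
Definition bounded_sq (E : set V) (N : V -> R) (A : V -> V) :=
  exists2 M, 0 <= M & forall x, E x -> E (A x) /\ N (A x) ^+ 2 <= M * N x ^+ 2.

Variables (X : set V) (normX : V -> R) (Y : set V) (normY : V -> R).

Local Notation NI := (interp_norm X normX Y normY 2^-1).
Local Notation EI := (interp X normX Y normY 2^-1).

Lemma sqrK_ge0 (t : R) (v : V) : (0 <= sqrK X normX Y normY t v)%E.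
Proof.
apply: le_ereal_inf_tmp => _ [x [y [_ _ _ ->]]].
rewrite lee_fin; apply: addr_ge0; first exact: sqr_ge0.
by apply: mulr_ge0; exact: sqr_ge0.
Qed.

(** The operator sends a decomposition [v = x + y] to the decomposition
    [A v = A x + A y], at a cost multiplied by at most [M]; taking the infimum
    and then the integral bounds the interpolation norm. *)
Lemma interp_norm_bounded (A : V -> V) : {morph A : u v / u + v} ->
  bounded_sq X normX A -> bounded_sq Y normY A ->
  exists2 C : R, 0 < C & forall v, (NI (A v) <= C%:E * NI v)%E.
Proof.
move=> AD [M1 M10 AX] [M2 M20 AY].
pose M := M1 + M2 + 1.
have M0 : 0 < M by rewrite /M; lra.
have KA t v : (sqrK X normX Y normY t (A v) <= M%:E * sqrK X normX Y normY t v)%E.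
  rewrite -lee_pdivrMl//.
  apply: le_ereal_inf_tmp => _ [x [y [Xx Yy -> ->]]].
  rewrite lee_pdivrMl//.
  have [AXx nAx] := AX _ Xx; have [AYy nAy] := AY _ Yy.
  apply: (@le_trans _ _ (normX (A x) ^+ 2 + t ^+ 2 * normY (A y) ^+ 2)%:E).
    by apply: ereal_inf_lbound; exists (A x), (A y); rewrite AD; split.
  rewrite -EFinM lee_fin mulrDr; apply: lerD.
    apply: (le_trans nAx); apply: ler_wpM2r; [exact: sqr_ge0|rewrite /M; lra].
  rewrite [leRHS]mulrCA; apply: ler_wpM2l; first exact: sqr_ge0.
  apply: (le_trans nAy); apply: ler_wpM2r; [exact: sqr_ge0|rewrite /M; lra].
exists (Num.sqrt M); first by rewrite sqrtr_gt0.
move=> v; rewrite /interp_norm; set c : R := 2 * sin _ / _.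
have c0 : 0 <= c.
  by rewrite /c sin_pihalf mulr1 divr_ge0// pi_ge0.
have w0 (t : R) u : (0 <= (t `^ (- (2 * 2^-1) - 1))%:E * sqrK X normX Y normY t u)%E.
  by rewrite mule_ge0// ?lee_fin ?powR_ge0// sqrK_ge0.
have -> : (Num.sqrt M)%:E = sqrte M%:E by [].
rewrite -sqrteM; last by rewrite lee_fin ltW.
rewrite lee_sqrt; last first.
  rewrite !mule_ge0// ?lee_fin ?(ltW M0)//.
  by apply: integral_ge0 => t _; exact: w0.
rewrite muleCA; apply: lee_wpmul2l; first by rewrite lee_fin.
apply: ge0_le_integral_scale => // t _.
rewrite muleCA; apply: lee_wpmul2l; first by rewrite lee_fin powR_ge0.
exact: KA.
Qed.

Lemma interp_bounded (A : V -> V) : {morph A : u v / u + v} ->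
  bounded_sq X normX A -> bounded_sq Y normY A ->
  [/\ {homo A : v / EI v}, bounded_on EI NI A & continuous_on EI NI A].
Proof.
move=> AD AX AY; have [C C0 NA] := interp_norm_bounded AD AX AY.
have A0 : A 0 = 0 by apply: (addrI (A 0)); rewrite -AD !addr0.
have AN v : A (- v) = - A v.
  by apply/eqP; rewrite -subr_eq0 opprK -AD addNr A0.
split.
- move=> v; rewrite /interp/= => Ev; apply: (le_lt_trans (NA v)).
  by rewrite lte_mul_pinfty// ?lee_fin ?ltW// ge0_fin_numE ?sqrte_ge0.
- by exists C.
- move=> v _ e e0; exists (e / C); first by rewrite divr_gt0.
  move=> w _ wv; rewrite -AN -AD; apply: (le_lt_trans (NA _)).
  by rewrite -lte_pdivlMl// -EFinM mulrC.
Qed.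

End interpolation_of_operators.

(** * Neumann series of a nilpotent operator *)

Section neumann_series.
Context {R : realType} {V : lmodType R}.
Implicit Types A B : V -> V.

Lemma bounded_sq_id (E : set V) (N : V -> R) : bounded_sq E N id.
Proof. by exists 1 => // x Ex; rewrite mul1r. Qed.

Lemma bounded_sq_comp (E : set V) (N : V -> R) A B :
  bounded_sq E N A -> bounded_sq E N B -> bounded_sq E N (A \o B).
Proof.
move=> [M M0 HA] [K K0 HB]; exists (M * K); first exact: mulr_ge0.
move=> x Ex; have [EBx NBx] := HB _ Ex; have [EABx NABx] := HA _ EBx.
split=> //; apply: (le_trans NABx); rewrite -mulrA; exact: ler_wpM2l.
Qed.

(** The parallelogram-type inequality replaces the triangle inequality: it
    suffices for sums of operators bounded in the squared sense, and a Hilbert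
    direct sum inherits it directly from its components. *)
Definition quadratic_seminorm (E : set V) (N : V -> R) :=
  [/\ E 0,
      forall a v, E v -> E (a *: v) /\ N (a *: v) ^+ 2 = a ^+ 2 * N v ^+ 2 &
      forall u v, E u -> E v ->
        E (u + v) /\ N (u + v) ^+ 2 <= 2 * (N u ^+ 2 + N v ^+ 2)].

Section seminormed.
Variables (E : set V) (N : V -> R).
Hypothesis EN : quadratic_seminorm E N.

Lemma bounded_sqD A B : bounded_sq E N A -> bounded_sq E N B ->
  bounded_sq E N (fun v => A v + B v).
Proof.
have [_ _ ED] := EN; move=> [M M0 HA] [K K0 HB].
exists (2 * (M + K)); first by rewrite mulr_ge0// addr_ge0.
move=> x Ex; have [EAx NAx] := HA _ Ex; have [EBx NBx] := HB _ Ex.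
have [ES NS] := ED _ _ EAx EBx; split=> //.
by apply: (le_trans NS); rewrite -mulrA ler_pM2l// mulrDl lerD.
Qed.

Lemma bounded_sqZ a A : bounded_sq E N A -> bounded_sq E N (fun v => a *: A v).
Proof.
have [_ EZ _] := EN; move=> [M M0 HA].
exists (a ^+ 2 * M); first by rewrite mulr_ge0 ?sqr_ge0.
move=> x Ex; have [EAx NAx] := HA _ Ex; have [ES NS] := EZ a _ EAx.
by split=> //; rewrite NS -[leRHS]mulrA; apply: ler_wpM2l => //; exact: sqr_ge0.
Qed.

Lemma bounded_sq_sum (n : nat) (A : nat -> V -> V) :
  (forall k, bounded_sq E N (A k)) ->
  bounded_sq E N (fun v => \sum_(k < n) A k v).
Proof.
move=> HA; elim: n => [|n [M M0 IHn]].
  exists 0 => // x Ex; rewrite big_ord0.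
  have [E0 EZ _] := EN; have [_ N0] := EZ 0 0 E0.
  by rewrite scale0r in N0; rewrite N0 expr0n !mul0r.
have [K K0 HK] := bounded_sqD (ex_intro2 _ _ M M0 IHn) (HA n).
by exists K => // x Ex; rewrite big_ord_recr; exact: HK.
Qed.

End seminormed.

Variables (X : set V) (normX : V -> R) (Y : set V) (normY : V -> R).
Hypotheses (semiX : quadratic_seminorm X normX).
Hypotheses (semiY : quadratic_seminorm Y normY).

Local Notation NI := (interp_norm X normX Y normY 2^-1).
Local Notation EI := (interp X normX Y normY 2^-1).

(** The Neumann series of a nilpotent [Q] is a finite sum, so the inverse
    [c^-1 (1 + Q + ... + Q ^ (n-1))] of [c (1 - Q)] is a polynomial in [Q]. It is
    therefore bounded wherever [Q] is, hence on the interpolation space. *)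
Lemma interp_isomorphism_nilpotent (c : R) (Q A : V -> V) (n : nat) :
  c != 0 -> linear Q -> bounded_sq X normX Q -> bounded_sq Y normY Q ->
  iter n Q =1 cst 0 -> (forall v, A v = c *: (v - Q v)) ->
  continuous_on EI NI A /\ isomorphism_on EI NI A.
Proof.
move=> c0 Qlin QX QY Qn AE.
have QD : {morph Q : u v / u + v}.
  by move=> u v; have := Qlin 1 u v; rewrite !scale1r.
have Q0 : Q 0 = 0 by apply: (addrI (Q 0)); rewrite -QD !addr0.
have QZ a v : Q (a *: v) = a *: Q v.
  by have := Qlin a v 0; rewrite Q0 !addr0.
pose B v := c^-1 *: \sum_(k < n) iter k Q v.
have iterD k : {morph iter k Q : u v / u + v}.
  by elim: k => // k IHk u v; rewrite !iterS IHk QD.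
have iterZ k a v : iter k Q (a *: v) = a *: iter k Q v.
  by elim: k => // k IHk; rewrite !iterS IHk QZ.
have iterN k v : iter k Q (- v) = - iter k Q v by rewrite -scaleN1r iterZ scaleN1r.
have telescope v : \sum_(k < n) (iter k Q v - iter k.+1 Q v) = v.
  rewrite -(big_mkord xpredT (fun k => iter k Q v - iter k.+1 Q v)).
  under eq_bigr do rewrite -opprB.
  rewrite sumrN.
  by rewrite (telescope_sumr (fun k => iter k Q v))// Qn sub0r opprK.
have sumQ v : Q (\sum_(k < n) iter k Q v) = \sum_(k < n) iter k.+1 Q v.
  exact: (big_morph Q QD Q0).
have AK : cancel A B.
  move=> v; rewrite AE /B -[RHS]telescope scaler_sumr; apply: eq_bigr => k _.
  by rewrite iterZ scalerA mulVf// scale1r iterD iterN -iterSr.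
have BK : cancel B A.
  move=> v; rewrite AE /B QZ -scalerBr scalerA mulfV// scale1r sumQ.
  by rewrite -sumrB.
have AD : {morph A : u v / u + v}.
  by move=> u v; rewrite !AE QD -scalerDr opprD addrACA.
have BD : {morph B : u v / u + v}.
  move=> u v; rewrite /B -scalerDr -big_split/=; congr (_ *: _).
  by apply: eq_bigr => k _; exact: iterD.
have bA E N : quadratic_seminorm E N -> bounded_sq E N Q -> bounded_sq E N A.
  move=> EN QE; rewrite (_ : A = fun v => c *: (v + -1 *: Q v)); last first.
    by apply/funext => v; rewrite AE scaleN1r.
  apply: bounded_sqZ => //; apply: bounded_sqD => //; first exact: bounded_sq_id.
  exact: bounded_sqZ.
have bB E N : quadratic_seminorm E N -> bounded_sq E N Q -> bounded_sq E N B.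
  move=> EN QE.
  have QkE k : bounded_sq E N (iter k Q).
    elim: k => [|k IHk]; first exact: bounded_sq_id.
    exact: (bounded_sq_comp QE IHk).
  exact: (bounded_sqZ EN c^-1 (bounded_sq_sum EN n QkE)).
have [AE' Abd Act] := interp_bounded AD (bA _ _ semiX QX) (bA _ _ semiY QY).
have [BE' Bbd _] := interp_bounded BD (bB _ _ semiX QX) (bB _ _ semiY QY).
split=> //; split=> //.
- split; first by move=> v; exact: AE'.
  + by move=> u v _ _; exact: (can_inj AK).
  + by move=> v Ev; exists (B v); [exact: BE'|exact: BK].
- move=> a u v _ _; rewrite !AE Qlin scalerA [a * c]mulrC -scalerA -scalerDr.
  by congr (_ *: _); rewrite scalerBr opprD addrACA.
- by exists B => // v _; exact: AK.
Qed.

End neumann_series.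

(** * Continuously differentiable cutoffs *)

Section C1_functions.
Context {R : realType}.
Implicit Types f g : R -> R.

Definition C1 f := (forall t, derivable f t 1) /\ continuous (derive1 f).

Lemma C1_continuous f : C1 f -> continuous f.
Proof.
by move=> [df _] x; apply: differentiable_continuous; apply/derivable1_diffP.
Qed.

Lemma C1_is_derive f (f' : R -> R) : (forall t : R, is_derive t 1 f (f' t)) ->
  continuous f' -> C1 f /\ derive1 f = f'.
Proof.
move=> df cf'; have f'E : derive1 f = f'.
  by apply/funext => t; rewrite derive1E derive_val.
by split=> //; split; [|rewrite f'E].
Qed.

Lemma C1_mul f g : C1 f -> C1 g ->
  C1 (fun t => f t * g t) /\
  derive1 (fun t => f t * g t) = fun t => f t * derive1 g t + g t * derive1 f t.
Proof.
move=> [df cf'] [dg cg']; have cf := C1_continuous (conj df cf').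
have cg := C1_continuous (conj dg cg'); apply: C1_is_derive.
  move=> t; rewrite !derive1E -![_ t * _]/(_ t *: _).
  by apply: is_deriveM; exact: derivableP.
move=> t; apply: (@continuousD _ _ _ (fun t => f t * derive1 g t) (fun t => g t * derive1 f t)).
  by apply: (@continuousM _ _ f (derive1 g)); [exact: cf|exact: cg'].
by apply: (@continuousM _ _ g (derive1 f)); [exact: cg|exact: cf'].
Qed.

Lemma C1_comp f g : C1 f -> C1 g ->
  C1 (fun t => f (g t)) /\
  derive1 (fun t => f (g t)) = fun t => derive1 f (g t) * derive1 g t.
Proof.
move=> [df cf'] [dg cg']; have cg := C1_continuous (conj dg cg').
have fg t : derivable (f \o g) t 1.
  by apply/derivable1_diffP/differentiable_comp; exact/derivable1_diffP.
apply: C1_is_derive => t.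
  by split=> //; rewrite -derive1E derive1_comp.
apply: (@continuousM _ _ (fun t => derive1 f (g t)) (derive1 g)); last exact: cg'.
by apply: (@continuous_comp _ _ _ g (derive1 f)); [exact: cg|exact: cf'].
Qed.

Lemma C1_affine (a b : R) :
  C1 (fun t => a * t + b) /\ derive1 (fun t => a * t + b) = cst a.
Proof.
apply: C1_is_derive => t; last exact: cst_continuous.
have := @is_deriveD _ _ _ (fun t => a * t) (cst b) t 1 a 0.
rewrite addr0; apply.
have -> : (fun t => a * t) = a *: (@id R) by apply/funext.
by rewrite -[X in is_derive _ _ _ X]mulr1; apply: is_deriveZ.
Qed.

(** A quadratic remainder identifies the derivative at every point at once,
    in particular at the kinks of piecewise polynomial functions. *)
Lemma is_derive_quadratic f (x d C : R) :
  (forall h, `|f (x + h) - f x - d * h| <= C * h ^+ 2) -> is_derive x (1:R) f d.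
Proof.
move=> fq.
have fx : (fun h => h^-1 *: ((f \o shift x) (h *: 1) - f x)) @ 0^' --> d.
  apply/cvgrPdist_le => e e0; near=> h.
  have h0 : h != 0 by near: h; exact: nbhs_dnbhs_neq.
  rewrite /= -[h *: 1]/(h * 1) mulr1 -[h^-1 *: _]/(h^-1 * _) [h + x]addrC.
  have -> : d - h^-1 * (f (x + h) - f x) = - h^-1 * (f (x + h) - f x - d * h).
    by field.
  rewrite normrM normrN normfV ler_pdivrMl ?normr_gt0//.
  apply: (le_trans (fq h)); rewrite -(real_normK (num_real h)) expr2 mulrA mulrC.
  apply: ler_wpM2l => //.
  apply: (@le_trans _ _ ((`|C| + 1) * `|h|)).
    by apply: ler_wpM2r => //; rewrite (le_trans (ler_norm C))// lerDl.
  rewrite -ler_pdivlMl ?ltr_wpDl//.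
  near: h; apply: dnbhs0_le; rewrite mulr_gt0// invr_gt0 ltr_wpDl//.
split; first by apply/cvg_ex; exists d.
exact: cvg_lim fx.
Unshelve. all: by end_near. Qed.

Definition pos_sqr (x : R) := Num.max x 0 ^+ 2.

Lemma max0_continuous : continuous (fun x : R => Num.max x 0).
Proof. by move=> x; apply: continuous_max; [exact: cvg_id|exact: cvg_cst]. Qed.

Lemma C1_pos_sqr : C1 pos_sqr /\ derive1 pos_sqr = fun x => 2 * Num.max x 0.
Proof.
apply: C1_is_derive => x.
  apply: (@is_derive_quadratic _ _ _ 1) => h; rewrite mul1r /pos_sqr ler_norml.
  by case: (leP x 0) => x0; case: (leP (x + h) 0) => xh; apply/andP; split; nra.
by apply: cvgM; [exact: cvg_cst|exact: max0_continuous].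
Qed.

(** Applying the square of the positive part twice gives a continuously
    differentiable transition from 0 on the negative axis to 1 beyond 1, with a
    closed form for the derivative. *)
Definition cutoff (x : R) := 1 - pos_sqr (1 - pos_sqr x).

Lemma C1_cutoff : C1 cutoff /\
  derive1 cutoff = fun x => 4 * (Num.max (1 - pos_sqr x) 0 * Num.max x 0).
Proof.
have [Cp p'] := C1_pos_sqr; have [Ca a'] := C1_affine (- 1) 1.
have [C1p d1p] := C1_comp Ca Cp; have [C2p d2p] := C1_comp Cp C1p.
have [C3p d3p] := C1_comp Ca C2p.
have E : cutoff = (fun t => - 1 * pos_sqr (- 1 * pos_sqr t + 1) + 1).
  by apply/funext => t; rewrite /cutoff/= !mulN1r [RHS]addrC (addrC (- pos_sqr t)).
rewrite E; split=> //; rewrite d3p a' d2p d1p a' p'; apply/funext => t /=.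
by rewrite [-1 * pos_sqr t]mulN1r (addrC (- pos_sqr t)); ring.
Qed.

Lemma pos_sqr_le0 x : x <= 0 -> pos_sqr x = 0.
Proof. by move=> x0; rewrite /pos_sqr max_r// expr0n. Qed.

Lemma pos_sqr_ge0 x : 0 <= x -> pos_sqr x = x ^+ 2.
Proof. by move=> x0; rewrite /pos_sqr max_l. Qed.

Lemma cutoff0 x : x <= 0 -> cutoff x = 0.
Proof.
by move=> x0; rewrite /cutoff (pos_sqr_le0 x0) subr0 pos_sqr_ge0// expr1n subrr.
Qed.

Lemma cutoff1 x : 1 <= x -> cutoff x = 1.
Proof.
move=> x1; rewrite /cutoff (@pos_sqr_ge0 x) ?(le_trans _ x1)//.
by rewrite pos_sqr_le0 ?subr0// subr_le0 expr_ge1// (le_trans _ x1).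
Qed.

Lemma cutoff_norm_le1 x : `|cutoff x| <= 1.
Proof.
rewrite /cutoff; have := sqr_ge0 (Num.max x 0); rewrite -/(pos_sqr x).
move: (pos_sqr x) => y y0; rewrite /pos_sqr ler_norml.
by case: (leP (1 - y) 0) => y1; apply/andP; split; nra.
Qed.

Lemma derive1_cutoff_norm_le4 x : `|derive1 cutoff x| <= 4.
Proof.
have [_ ->] := C1_cutoff; rewrite !normrM ger0_norm//.
rewrite -[leRHS]mulr1 ler_pM2l//.
case: (leP x 0) => [x0|x0]; first by rewrite normr0 mulr0.
rewrite pos_sqr_ge0 ?(ltW x0)//.
case: (leP (1 - _) 0) => [x1|x1]; first by rewrite normr0 mul0r.
by rewrite !gtr0_norm// mulr_ile1// ?ltW//; nra.
Qed.

Lemma derive1_cutoff0 x : (x <= 0) || (1 <= x) -> derive1 cutoff x = 0.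
Proof.
have [_ ->] := C1_cutoff; case/orP => x0; first by rewrite [Num.max x 0]max_r// !mulr0.
have x1 : 0 <= x by rewrite (le_trans _ x0).
by rewrite max_r ?mul0r ?mulr0// pos_sqr_ge0// subr_le0 expr_ge1.
Qed.

(** The function is 0 up to [1/n], 1 from [2/n] on, and has derivative O(n). *)
Definition ramp (n : nat) (x : R) := cutoff (n%:R * x + -1).

Lemma C1_ramp n : C1 (ramp n) /\
  derive1 (ramp n) = fun x => derive1 cutoff (n%:R * x + -1) * n%:R.
Proof.
have [Ca a'] := C1_affine n%:R (-1); have [Cc _] := C1_cutoff.
by have [Cr r'] := C1_comp Cc Ca; split=> //; rewrite r' a'.
Qed.

Lemma ramp0 n x : n%:R * x <= 1 -> ramp n x = 0.
Proof. by move=> nx; apply: cutoff0; rewrite subr_le0. Qed.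

Lemma ramp_cvg1 x : 0 < x -> ramp n x @[n --> \oo] --> (1 : R).
Proof.
move=> x0; apply: cvg_near_cst; near=> n.
apply: cutoff1; rewrite lerBrDr -ler_pdivrMr//.
by near: n; exact: nbhs_infty_ger.
Unshelve. all: by end_near. Qed.

End C1_functions.

(** * Integration and square-integrable classes on the interval *)

Section L2_interval_facts.
Context {R : realType}.
Variable T : R.

Local Notation mR := (measurableTypeR R).
Local Notation mu := (@lebesgue_measure R).
Local Notation nu := (leb0T T).

Lemma leb0T_fin_num : nu setT \is a fin_num.
Proof.
rewrite /leb0T /= /mrestr setTI lebesgue_measure_itv/= lte_fin.
by case: ifP.
Qed.

Lemma integral_leb0T (h : mR -> \bar R) : measurable_fun [set: mR] h ->
  (\int[nu]_t h t = \int[mu]_(t in `]0%R, T[) h t)%E.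
Proof.
move=> mh; rewrite integralE [RHS]integralE.
by congr (_ - _)%E; apply: ge0_integral_leb0T => //;
  [exact: measurable_funepos|exact: measurable_funeneg].
Qed.

Lemma integrable_leb0T (h : mR -> \bar R) : measurable_fun [set: mR] h ->
  nu.-integrable setT h <-> mu.-integrable `]0, T[ h.
Proof.
move=> mh; have mh' : measurable_fun (`]0, T[ : set mR) h by exact: measurable_funS mh.
have E : (\int[nu]_t `|h t| = \int[mu]_(t in `]0%R, T[) `|h t|)%E.
  by apply: integral_leb0T; exact: measurableT_comp.
by split=> /integrableP[_ hoo]; apply/integrableP; split=> //;
  [rewrite -E|rewrite E].
Qed.

Lemma ae_leb0T (P : R -> Prop) :
  {ae mu, forall t, t \in `]0, T[ -> P t} -> {ae nu, forall t, P t}.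
Proof.
have mD : measurable (`]0, T[ : set mR) by exact: measurable_itv.
move=> [N [mN N0 PN]]; exists (N `|` ~` `]0, T[); split.
- by apply: measurableU => //; exact: measurableC.
- rewrite /leb0T /= /mrestr setIUl setICl setU0.
  by apply: (subset_measure0 _ _ _ N0) => //; exact: measurableI.
- move=> t /= Pt; case: (pselect (t \in `]0, T[)) => tD; last by right.
  by left; apply: PN => /= /(_ tD).
Qed.

Lemma ae_eq_leb0T (f g : mR -> R) :
  {in `]0, T[, f =1 g} -> f = g %[ae nu].
Proof.
by move=> fg; apply: ae_leb0T; apply: aeW => t tD _; exact: fg.
Qed.

Lemma L2fun_integrable (f : L2fun T) : nu.-integrable setT (EFin \o f).
Proof. by apply/Lfun1_integrable/Lfun_subset12; [exact: leb0T_fin_num|exact: LfunP]. Qed.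

Lemma continuous_bounded_itv (phi : R -> R) : continuous phi ->
  exists2 C, 0 < C & forall t, t \in `]0, T[ -> `|phi t| <= C.
Proof.
move=> cphi.
have : bounded_set (phi @` `[0, T]).
  apply: compact_bounded; apply: continuous_compact.
    exact: continuous_subspaceT.
  exact: segment_compact.
move=> [M [Mr HM]]; exists (`|M| + 1); first by rewrite ltr_wpDl.
move=> t tD; apply: (HM (`|M| + 1)); first by rewrite ltr_pwDr// ler_norm.
by exists t => //; exact: subset_itv_oo_cc.
Qed.

Lemma integrable_mul_continuous (f phi : mR -> R) : measurable_fun setT f ->
  nu.-integrable setT (EFin \o f) -> continuous (phi : R -> R) ->
  nu.-integrable setT (EFin \o (fun t => f t * phi t)).
Proof.
move=> mf fi cphi.
have mphi : measurable_fun [set: mR] phi by exact: continuous_measurable_fun.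
have mfphi : measurable_fun [set: mR] (EFin \o (fun t => f t * phi t)).
  by apply/measurable_EFinP; exact: measurable_funM.
apply/(integrable_leb0T mfphi).
have {}fi : mu.-integrable `]0, T[ (EFin \o f).
  by apply/integrable_leb0T => //; exact/measurable_EFinP.
apply: (@integrableMl _ _ _ mu _ _ (EFin \o f) phi) => //.
  exact: measurable_funS mphi.
have [C C0 phiC] := continuous_bounded_itv cphi.
exists C; split; first exact: num_real.
by move=> y Cy t tD; apply: le_trans (phiC t tD) (ltW Cy).
Qed.

(** Weak derivatives only involve integrals against continuous functions, and
    these depend linearly on the class and not on its representative. *)
Definition pairing (u : L2 T) (phi : R -> R) : R :=
  \int[nu]_t (repr u t * phi t).

Lemma repr_pi (f : L2fun T) :
  (repr (\pi_(L2 T)%qT f) : mR -> R) = f %[ae nu].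
Proof. by apply/L2_eqP; rewrite reprK. Qed.

Lemma L2_pi0 : (\pi_(L2 T)%qT 0 : L2 T) = 0.
Proof. exact: (@pi_zeror _ _ _ _ _ {ideal_quot (@ae0 R T)}). Qed.

Lemma pairing_pi (f : L2fun T) (phi : R -> R) : continuous phi ->
  pairing (\pi_(L2 T)%qT f) phi = \int[nu]_t (f t * phi t).
Proof.
move=> cphi; have mphi : measurable_fun [set: mR] phi by exact: continuous_measurable_fun.
congr fine; apply: ae_eq_integral => //.
- by apply/measurable_EFinP; exact: measurable_funM.
- by apply/measurable_EFinP; exact: measurable_funM.
- apply: (@filterS _ _ (ae_filter_ringOfSetsType nu)) (repr_pi f) => t ft _.
  by congr (_ * _)%:E; exact: ft.
Qed.

Lemma pairing_integrable (f : L2fun T) (phi : R -> R) : continuous phi ->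
  nu.-integrable setT (EFin \o (fun t => f t * phi t)).
Proof. by move=> cphi; apply: integrable_mul_continuous => //; exact: L2fun_integrable. Qed.

Lemma pairing_linear (phi : R -> R) (a : R) (u v : L2 T) : continuous phi ->
  pairing (a *: u + v) phi = a * pairing u phi + pairing v phi.
Proof.
move=> cphi.
rewrite -[u]reprK -[v]reprK -[a *: _]/(L2scale a _) L2scale_pi L2addE !pairing_pi//.
rewrite -RintegralZl//; last exact: pairing_integrable.
rewrite -RintegralD//; last 2 first.
- apply: (@eq_integrable _ _ _ nu _ measurableT
    (EFin \o (fun t => (a *: repr u : L2fun T) t * phi t))) => //.
    by move=> t _; rewrite /= mulrA.
  exact: pairing_integrable.
- exact: pairing_integrable.
by apply: eq_Rintegral => t _; rewrite mulrDl mulrA.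
Qed.

Lemma pairingDr (u : L2 T) (phi psi : R -> R) : continuous phi -> continuous psi ->
  pairing u (fun t => phi t + psi t) = pairing u phi + pairing u psi.
Proof.
move=> cphi cpsi; rewrite /pairing -RintegralD//; try exact: pairing_integrable.
by apply: eq_Rintegral => t _; rewrite mulrDr.
Qed.

Lemma measurable_norm_sqr (g : mR -> R) : measurable_fun setT g ->
  measurable_fun setT (fun t => (`|g t| `^ 2)%:E).
Proof.
move=> mg; apply/measurable_EFinP.
by apply: (measurableT_comp (measurable_powR _)); exact: measurableT_comp.
Qed.

Lemma L2norm_pi (f : L2fun T) :
  L2norm (\pi_(L2 T)%qT f) = fine 'N[nu]_2%:E[EFin \o f]%E.
Proof.
rewrite /L2norm unlock /Lnorm; congr (fine (_ `^ _)%E).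
apply: ae_eq_integral => //.
- exact: measurable_norm_sqr.
- exact: measurable_norm_sqr.
- apply: (@filterS _ _ (ae_filter_ringOfSetsType nu)) (repr_pi f) => t ft _.
  by congr (`|_%:E| `^ _)%E; exact: ft.
Qed.

Lemma L2norm_ge0 (u : L2 T) : 0 <= L2norm u.
Proof. by rewrite fine_ge0// Lnorm_ge0. Qed.

Lemma ler_L2normD (u v : L2 T) : L2norm (u + v) <= L2norm u + L2norm v.
Proof. by rewrite -[u]reprK -[v]reprK L2addE !L2norm_pi; exact: ler_LnormD. Qed.

Lemma L2normZ (a : R) (u : L2 T) : L2norm (a *: u) = `|a| * L2norm u.
Proof.
rewrite -[u]reprK -[a *: _]/(L2scale a _) L2scale_pi !L2norm_pi LnormZ fineM//.
by rewrite -finite_norm_fine.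
Qed.

End L2_interval_facts.

(** * Uniqueness of weak derivatives *)

Section weak_derivative_uniqueness.
Context {R : realType}.
Variable T : R.

Local Notation mR := (measurableTypeR R).
Local Notation mu := (@lebesgue_measure R).
Local Notation nu := (leb0T T).

Lemma test_function_C1 (phi : R -> R) : test_function T phi -> C1 phi.
Proof. by case. Qed.

(** Test functions converging to the indicator of [`]0, x[]. *)
Definition plateau (n : nat) (x t : R) := ramp n.+1 t * ramp n.+1 (x - t).

Lemma plateau_test (n : nat) (x : R) : x <= T -> test_function T (plateau n x).
Proof.
move=> xT; have [Ca _] := C1_affine (-1) x.
have [Cr _] := @C1_ramp R n.+1.
have [Crx _] := C1_comp Cr Ca.
have E : plateau n x = fun t => ramp n.+1 t * ramp n.+1 (-1 * t + x).
  by apply/funext => t; rewrite /plateau mulN1r addrC.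
have [d c] : C1 (plateau n x) by rewrite E; exact: (C1_mul Cr Crx).1.
split=> //; exists n.+1%:R^-1, (x - n.+1%:R^-1); split.
- by rewrite invr_gt0.
- by rewrite ltrBlDr ltr_pwDr// invr_gt0.
- move=> t; apply: contraNT; rewrite negb_and -!ltNge /plateau => /orP[tn|tn].
    by rewrite ramp0 ?mul0r// mulrC -ler_pdivlMr ?mul1r ?ltW.
  rewrite [ramp _ (x - t)]ramp0 ?mulr0// mulrC -ler_pdivlMr ?mul1r//.
  by rewrite lerBlDr -lerBlDl ltW.
Qed.

Lemma plateau_cvg (x t : R) :
  plateau n x t @[n --> \oo] --> ((t \in `]0, x[)%:R : R).
Proof.
have ramp1 y : 0 < y -> ramp n.+1 y @[n --> \oo] --> (1 : R).
  by move=> y0; rewrite (cvg_shiftS (fun n => ramp n y)); exact: ramp_cvg1.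
have ramp00 y : y <= 0 -> forall n, ramp n y = 0 :> R.
  by move=> y0 n; apply: ramp0; rewrite (@le_trans _ _ 0)// mulr_ge0_le0.
rewrite /plateau in_itv/=; case: (ltP 0 t) => t0 /=; last first.
  by under eq_fun do rewrite (ramp00 t)// mul0r; exact: cvg_cst.
case: (ltP t x) => tx /=; last first.
  by under eq_fun do rewrite (ramp00 (x - t)) ?subr_le0// mulr0; exact: cvg_cst.
by rewrite -[1%:R]mulr1; apply: cvgM; apply: ramp1; rewrite ?subr_gt0.
Qed.

(** Dominated convergence, with dominating function [C |f|]. *)
Lemma integral_multiplier_cvg (f : L2fun T) (w_ : nat -> R -> R) (w : mR -> R) (C : R) :
  (forall n, continuous (w_ n)) -> measurable_fun setT w ->
  (forall n t, t \in `]0, T[ -> `|w_ n t| <= C) ->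
  (forall t, t \in `]0, T[ -> w_ n t @[n --> \oo] --> w t) ->
  \int[nu]_t (f t * w_ n t) @[n --> \oo] --> \int[nu]_t (f t * w t).
Proof.
move=> cw mw wC wl.
have fwi n : nu.-integrable setT (fun t => (f t * w_ n t)%:E).
  exact: pairing_integrable.
have mfw : measurable_fun [set: mR] (fun t => (f t * w t)%:E).
  by apply/measurable_EFinP; exact: measurable_funM.
have fCi : nu.-integrable setT (fun t => `|f t * C|%:E).
  have cC : continuous (cst C : R -> R) by move=> ?; exact: cst_continuous.
  by have := integrable_abse (pairing_integrable f cC).
have flim : {ae nu, forall t, setT t ->
    (f t * w_ n t)%:E @[n --> \oo] --> (f t * w t)%:E}.
  apply: ae_leb0T; apply: aeW => t tT _; apply: cvg_EFin; first exact: nearW.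
  by apply: cvgMr; exact: wl.
have fdom : {ae nu, forall t n, setT t ->
    (`|(f t * w_ n t)%:E| <= `|f t * C|%:E)%E}.
  apply: ae_leb0T; apply: aeW => t tT n _.
  rewrite lee_fin !normrM; apply: ler_wpM2l => //.
  exact: le_trans (wC n t tT) (ler_norm C).
have [fi _ fl] := dominated_convergence measurableT
  (fun n => measurable_int _ (fwi n)) mfw flim fCi fdom.
have /fine_cvgP[] : (\int[nu]_t (f t * w_ n t)%:E)%E @[n --> \oo] -->
    (\int[nu]_t (f t * w t))%:E.
  by rewrite fineK//; exact: integrable_fin_num.
by [].
Qed.

Lemma measurable_prefix (x : R) :
  measurable_fun [set: mR] (fun t => (t \in `]0%R, x[)%:R : R).
Proof.
have -> : (fun t => (t \in `]0%R, x[)%:R : R) = \1_(`]0%R, x[ : set mR).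
  by apply/funext => t; rewrite indicE mem_setE.
exact: measurable_indic.
Qed.

Lemma integral_prefix_eq0 (f : L2fun T) (x : R) : x <= T ->
  (forall phi, test_function T phi -> \int[nu]_t (f t * phi t) = 0) ->
  \int[nu]_t (f t * (t \in `]0%R, x[)%:R) = 0.
Proof.
move=> xT f0.
have cplateau n : continuous (plateau n x).
  exact: C1_continuous (test_function_C1 (plateau_test n xT)).
have plateau_le1 n t : `|plateau n x t| <= 1.
  by rewrite normrM mulr_ile1// cutoff_norm_le1.
have := @integral_multiplier_cvg f (plateau ^~ x) _ 1 cplateau (measurable_prefix x)
  (fun n t _ => plateau_le1 n t) (fun t _ => @plateau_cvg x t).
move/cvg_lim => <-//; apply: lim_near_cst => //; apply: nearW => n.
exact: f0 (plateau_test n xT).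
Qed.

(** The fundamental lemma of the calculus of variations: in the limit of the
    plateaus, the primitive [x |-> \int_0^x f] vanishes, and Lebesgue's
    differentiation theorem recovers [f] almost everywhere from it. *)
Lemma L2_eq0 (u : L2 T) :
  (forall phi, test_function T phi -> pairing u phi = 0) -> u = 0.
Proof.
move=> u0; rewrite -[u]reprK -[RHS]reprK; set f := repr u.
have mD : measurable (`]0, T[ : set mR) by exact: measurable_itv.
have mf : measurable_fun [set: mR] f by [].
pose G : R -> R := (f : R -> R) \_ `]0, T[.
have fi : mu.-integrable `]0, T[ (EFin \o f).
  by apply/integrable_leb0T; [exact/measurable_EFinP|exact: L2fun_integrable].
have Gloc : locally_integrable [set: R] G by exact: integrable_locally_restrict.
have Gi y : mu.-integrable `]0, y] (EFin \o G).
  have : mu.-integrable setT (EFin \o G).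
    by rewrite /G -restrict_EFin; apply/integrable_restrict => //; rewrite setTI.
  exact: integrableS.
(* Beyond [T] the primitive of [G] is that of [f] at [Num.min y T]. *)
have G0 y : \int[mu]_(t in `]0, y]) G t = 0.
  rewrite -Rintegral_itv_bndo_bndc; last first.
    by apply: integrableS (Gi y) => //; exact: subset_itv_oo_oc.
  pose x := Num.min y T.
  transitivity (\int[nu]_t (f t * (t \in `]0%R, x[)%:R)); last first.
    by apply: (integral_prefix_eq0 _ u0); rewrite ge_min lexx orbT.
  rewrite Rintegral_mkcond /Rintegral integral_leb0T; last first.
    by apply/measurable_EFinP; exact: measurable_funM (measurable_prefix x).
  rewrite [in RHS]integral_mkcond; congr fine; apply: eq_integral => t _.
  rewrite /G !patchE/= !mem_setE /x !in_itv/= lt_min.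
  by case: (ltP 0 t) => //= t0; case: (ltP t T) => //= tT; case: (ltP t y) => //= _;
    rewrite ?mulr1 ?mulr0.
have := FTC1 Gi Gloc.
move=> FTC; apply/L2_eqP.
have r0 : (repr (0 : L2 T) : mR -> R) = cst 0 %[ae nu].
  by rewrite -L2_pi0; exact: repr_pi.
apply: (ae_eq_trans _ (ae_eq_sym r0)).
apply: ae_leb0T; apply: (@filterS _ _ (ae_filter_ringOfSetsType mu)) FTC => t /= Ft tD _.
have [|_] := Ft; first by move: tD; rewrite in_itv/= => /andP[].
under eq_fun do rewrite G0.
by rewrite derive1_cst /G patchE mem_set// => <-.
Qed.

Lemma weak_deriv_unique (u g h : L2 T) :
  is_weak_deriv u g -> is_weak_deriv u h -> g = h.
Proof.
move=> ug uh; apply/eqP; rewrite -subr_eq0; apply/eqP; apply: L2_eq0 => phi tphi.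
have cphi : continuous phi by exact: C1_continuous (test_function_C1 tphi).
rewrite -scaleN1r addrC pairing_linear// mulN1r; apply/eqP.
by rewrite addrC subr_eq0 -eqr_opp -[X in X == _](ug _ tphi) -[X in _ == X](uh _ tphi).
Qed.

(** [weak_deriv] is obtained by choice, so any weak derivative can be used to
    compute it only because there is just one. *)
Lemma weak_derivP (u g : L2 T) : is_weak_deriv u g -> weak_deriv u = g.
Proof.
move=> ug; rewrite /weak_deriv; case: xgetP => [h _ uh|/(_ g)//].
exact: weak_deriv_unique uh ug.
Qed.

Lemma is_weak_deriv_linear (a : R) (u v g h : L2 T) :
  is_weak_deriv u g -> is_weak_deriv v h ->
  is_weak_deriv (a *: u + v) (a *: g + h).
Proof.
move=> ug vh phi tphi; have [dphi cphi' _] := tphi.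
have cphi : continuous phi by exact: C1_continuous (test_function_C1 tphi).
rewrite -/(pairing _ _) -/(pairing (a *: g + h) phi) !pairing_linear//.
by rewrite opprD -mulrN; congr (a * _ + _); [exact: ug|exact: vh].
Qed.

End weak_derivative_uniqueness.

(** * The delay operator *)

Section delay_operator.
Context {R : realType}.
Variable T : R.

Local Notation mR := (measurableTypeR R).
Local Notation mu := (@lebesgue_measure R).
Local Notation nu := (leb0T T).
Local Open Scope quotient_scope.

Lemma L2_pi_eq (f g : L2fun T) : {in `]0, T[, (f : mR -> R) =1 g} ->
  \pi_(L2 T) f = \pi_(L2 T) g.
Proof. by move=> fg; apply/L2_eqP; exact: ae_eq_leb0T. Qed.

Lemma delay_linear (a : R) : linear (@delay R T a).
Proof.
move=> c u v; rewrite -[u]reprK -[v]reprK.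
rewrite -[c *: \pi_(L2 T) _]/(L2scale c _) L2scale_pi L2addE !delay_pi.
rewrite -[c *: \pi_(L2 T) _]/(L2scale c _) L2scale_pi L2addE.
apply: L2_pi_eq => t _.
rewrite -[RHS]/(c * delay_fun T a (repr u) t + delay_fun T a (repr v) t).
rewrite -[LHS]/(delay_fun T a (c *: repr u + repr v : L2fun T) t) /delay_fun !patchE.
by case: ifPn => // _; rewrite -[point]/(0 : R) mulr0 addr0.
Qed.

Lemma delay_delay (a b : R) (u : L2 T) : 0 <= a -> 0 <= b ->
  delay a (delay b u) = delay (a + b) u.
Proof.
move=> a0 b0; rewrite -[u]reprK (delay_pi b) (delay_pi a) (delay_pi (a + b)).
apply: L2_pi_eq => t; rewrite in_itv/= => /andP[t0 tT].
rewrite /= /delay_fun !patchE/= opprD addrA !mem_setE !in_itv/=.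
case: (ltP 0 (t - a - b)) => tab /=; last by case: ifP.
have -> : 0 < t - a < T by apply/andP; split; lra.
by [].
Qed.

Lemma delay_ge (a : R) (u : L2 T) : T <= a -> delay a u = 0.
Proof.
move=> Ta; rewrite -[u]reprK delay_pi -L2_pi0.
apply: L2_pi_eq => t; rewrite in_itv/= => /andP[t0 tT].
rewrite /delay_fun patchE mem_setE in_itv/= ifF//; apply/negbTE.
by rewrite negb_and -leNgt; apply/orP; left; lra.
Qed.

Lemma L2norm_delay (a : R) (u : L2 T) : L2norm (delay a u) <= L2norm u.
Proof.
rewrite -[u]reprK delay_pi !L2norm_pi; set f := repr u.
apply: fine_le.
- by rewrite -finite_norm_fine.
- by rewrite -finite_norm_fine.
rewrite unlock /Lnorm; apply: gt0_ler_poweR => //.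
- by rewrite in_itv/= leey andbT integral_ge0.
- by rewrite in_itv/= leey andbT integral_ge0.
- exact: ge0_integral_delay.
Qed.

Lemma integral_translate (a : R) (h : mR -> \bar R) : measurable_fun setT h ->
  (\int[mu]_t h (t - a)%R = \int[mu]_t h t)%E.
Proof.
move=> mh; pose tr : mR -> mR := fun t => t - a.
have pos (k : mR -> \bar R) : measurable_fun setT k -> (forall t, 0 <= k t)%E ->
    (\int[mu]_t k (t - a)%R = \int[mu]_t k t)%E.
  move=> mk k0; transitivity (\int[pushforward mu tr]_t k t)%E.
    by rewrite ge0_integral_pushforward//; exact: measurable_translate.
  apply: eq_measure_integral => [|mf' A mA _]; first exact: measurable_translate.
  exact: lebesgue_measure_translate.
rewrite integralE [RHS]integralE -[fun t => h (t - a)%R]/(h \o tr).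
rewrite funepos_comp funeneg_comp; congr (_ - _)%E.
  by apply: (pos h^\+%E) => //; exact: measurable_funepos.
by apply: (pos h^\-%E) => //; exact: measurable_funeneg.
Qed.

(** The adjoint of the delay is the advance of the test function. The delay
    pushes part of [u] past the time [T], where [phi] has to vanish. *)
Lemma pairing_delay (a : R) (u : L2 T) (phi : R -> R) : 0 <= a ->
  continuous phi -> (forall t, T <= t -> phi t = 0) ->
  pairing (delay a u) phi = pairing u (fun t => phi (t + a)).
Proof.
move=> a0 cphi phiT; rewrite -[u]reprK delay_pi; set f := repr u.
have cphia : continuous (fun t => phi (t + a)).
  move=> t; apply: (@continuous_comp _ _ _ (fun t => t + a) phi); last exact: cphi.
  by apply: cvgD; [exact: cvg_id|exact: cvg_cst].
rewrite !pairing_pi//.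
have mf : measurable_fun [set: mR] f by [].
have mD : measurable (`]0, T[ : set mR) by exact: measurable_itv.
have mfD : measurable_fun [set: mR] (f \_ `]0, T[).
  by apply/(@measurable_restrictT _ _ mR _ `]0, T[) => //; exact: measurable_funS mf.
have mphi : measurable_fun [set: mR] phi by exact: continuous_measurable_fun.
have mphia : measurable_fun [set: mR] (fun t => phi (t + a)) by exact: continuous_measurable_fun.
rewrite /Rintegral integral_leb0T; last first.
  apply/measurable_EFinP; apply: measurable_funM => //; exact: measurable_delay_fun.
rewrite integral_leb0T; last first.
  by apply/measurable_EFinP; exact: measurable_funM.
congr fine; rewrite integral_mkcond [RHS]integral_mkcond.
(* [h] is the integrand on the whole line, after the change of variable. *)
pose h t := ((f \_ `]0, T[) t * phi (t + a))%:E.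
rewrite -[RHS](_ : (\int[mu]_t h t)%E = _); last first.
  by apply: eq_integral => t _; rewrite /h !patchE; case: ifPn; rewrite ?mul0r.
rewrite -(integral_translate a); last first.
  by apply/measurable_EFinP; exact: measurable_funM.
apply: eq_integral => t _; rewrite /h subrK patchE; case: ifPn => //.
rewrite mem_setE in_itv/= negb_and -!leNgt => /orP[t0|tT].
  rewrite patchE ifF ?mul0r//; apply/negbTE.
  by rewrite mem_setE in_itv/= negb_and -!leNgt; apply/orP; left; lra.
by rewrite phiT// mulr0.
Qed.

End delay_operator.

(** * The delay acts on H^1 functions vanishing at the initial time *)

Section delay_H1.
Context {R : realType}.
Variable T : R.

Local Notation mR := (measurableTypeR R).
Local Notation mu := (@lebesgue_measure R).
Local Notation nu := (leb0T T).

Lemma vanishes_at_0_small (u : L2 T) : vanishes_at_0 u -> forall eta : R, 0 < eta ->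
  exists2 delta, 0 < delta &
    {ae nu, forall t, t \in `]0, T[ -> t < delta -> `|repr u t| <= eta}.
Proof.
move=> [f [cf uf f0]] eta eta0.
case: (leP T 0) => [T0|T0].
  exists 1 => //; apply: aeW => t; rewrite in_itv/= => /andP[t0 tT]; lra.
have f_cvg0 : (f : R -> R) @ within `[0, T] (nbhs (0 : R)) --> (0 : R).
  rewrite -[X in _ --> X]f0; have /subspace_continuousP := cf; apply.
  by rewrite /= in_itv/= lexx ltW.
have /cvgr0Pnorm_le/(_ eta eta0) := f_cvg0.
rewrite near_withinE => -[/= d d0 fd]; exists d => //.
apply: (@filterS _ _ (ae_filter_ringOfSetsType nu)) uf => t uft tD td.
rewrite (uft I); apply: fd; last exact: subset_itv_oo_cc.
by move: tD; rewrite in_itv/= => /andP[t0 _]; rewrite /ball/= sub0r normrN gtr0_norm.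
Qed.

(** The derivative of the ramp is O(n), but lives on an interval of length
    O(1/n) shrinking to 0, where [u] tends to 0 by the initial condition. *)
Lemma pairing_ramp_cvg0 (u : L2 T) (psi : R -> R) : vanishes_at_0 u ->
  continuous psi ->
  pairing u (fun t => psi t * derive1 (ramp n.+1) t) @[n --> \oo] --> (0 : R).
Proof.
move=> u0 cpsi; have [C C0 psiC] := continuous_bounded_itv T cpsi.
have cdr n : continuous (derive1 (@ramp R n.+1)) by have [[]] := @C1_ramp R n.+1.
apply/cvgr0Pnorm_le => e e0.
have eta0 : 0 < e / (8 * C) by rewrite divr_gt0// mulr_gt0.
have [d d0 ud] := vanishes_at_0_small u0 eta0.
near=> n.
have nd : 2 / n.+1%:R < d.
  rewrite ltr_pdivrMr// mulrC -ltr_pdivrMr//.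
  apply: (@lt_trans _ _ n%:R); last by rewrite ltr_nat.
  by near: n; exact: nbhs_infty_gtr.
set k : R := n.+1%:R; have k0 : 0 < k by [].
have cprod : continuous (fun t => psi t * derive1 (ramp n.+1) t).
  by move=> t; apply: cvgM; [exact: cpsi|exact: cdr].
have ui := pairing_integrable (repr u) cprod.
rewrite -lee_fin EFin_normr_Rintegral//.
apply: (le_trans (le_abse_integral nu measurableT (measurable_int _ ui))).
(* The ramp is constant to the right of [A]. *)
pose A : set mR := (`]0, 2 / k[)%classic.
have mA : measurable A by exact: measurable_itv.
pose K := e / (8 * C) * (C * (4 * k)).
have K0 : 0 <= K by apply/ltW/mulr_gt0 => //; rewrite !mulr_gt0.
apply: (@le_trans _ _ (\int[nu]_t (K * \1_A t)%:E)%E).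
  apply: ae_ge0_le_integral => //.
  - by apply: measurableT_comp => //; exact: measurable_int ui.
  - by move=> t _; rewrite lee_fin mulr_ge0.
  - by apply/measurable_EFinP; exact: measurable_funM.
  have tA : {ae nu, forall t, t \in `]0, T[}.
    by apply: ae_leb0T; exact: aeW.
  apply: (@filterS2 _ _ (ae_filter_ringOfSetsType nu)) ud tA => t utd tT _.
  rewrite lee_fin !normrM indicE mem_setE in_itv/=.
  have [_ ->] := @C1_ramp R n.+1.
  move: (tT); rewrite in_itv/= => /andP[t0 _]; rewrite t0/=.
  case: ltP => tk.
    rewrite mulr1; apply: ler_pM => //.
      by apply: utd => //; apply: lt_trans nd.
    apply: ler_pM => //; first exact: psiC.
    by rewrite normrM normr_nat ler_pM2r// derive1_cutoff_norm_le4.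
  rewrite derive1_cutoff0 ?mul0r ?normr0 ?mulr0//; apply/orP; right.
  by rewrite lerBrDr mulrC -ler_pdivrMr.
under eq_integral do rewrite EFinM.
rewrite ge0_integralZl_EFin//; last exact/measurable_EFinP.
rewrite integral_indic// setIT.
apply: (@le_trans _ _ (K%:E * mu A)%E).
  apply: lee_wpmul2l; first by rewrite lee_fin.
  by rewrite /leb0T /= /mrestr; apply: le_measure; rewrite ?inE//; exact: measurableI.
rewrite lebesgue_measure_itv/= lte_fin divr_gt0// -EFinB subr0 -EFinM lee_fin.
by rewrite le_eqVlt; apply/orP; left; apply/eqP; rewrite /K; field; rewrite !gt_eqF.
Unshelve. all: by end_near. Qed.

(** After the change of variable the test function becomes [phi (t + a)], which
    vanishes near [T] but maybe not near 0. Multiplying it by a ramp gives a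
    genuine test function; as the ramp steepens, the extra term of the product
    rule tends to 0 because [u] vanishes at 0. *)
Lemma is_weak_deriv_delay (a : R) (u g : L2 T) : 0 <= a ->
  is_weak_deriv u g -> vanishes_at_0 u ->
  is_weak_deriv (delay a u) (delay a g).
Proof.
move=> a0 ug u0 phi tphi; have [dphi cphi' [a1 [b1 [a10 b1T supp]]]] := tphi.
have Cphi := test_function_C1 tphi; have cphi := C1_continuous Cphi.
have phiT t : b1 < t -> phi t = 0.
  move=> bt; apply/eqP; apply: contraTT bt => /supp/andP[_ tb].
  by rewrite -leNgt.
have phi'T t : T <= t -> derive1 phi t = 0.
  move=> Tt; rewrite derive1E (_ : 'D_1 phi t = 'D_1 (cst 0 : R -> R) t).
    by rewrite derive_cst.
  apply: near_eq_derive; near=> s; apply: phiT; near: s.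
  by apply: lt_nbhsr; exact: lt_le_trans Tt.
rewrite -/(pairing _ _) -/(pairing (delay a g) phi) !pairing_delay//; last first.
  by move=> t Tt; apply: phiT; exact: lt_le_trans Tt.
have [Ca a'] := C1_affine 1 a; have [C1psi psi'] := C1_comp Cphi Ca.
pose psi t := phi (1 * t + a).
have psiE : (fun t => phi (t + a)) = psi by apply/funext => t; rewrite /psi mul1r.
have psi'E : (fun t => derive1 phi (t + a)) = derive1 psi.
  by rewrite /psi psi' a'; apply/funext => t; rewrite mulr1 mul1r.
rewrite psiE psi'E; have cpsi : continuous psi by exact: C1_continuous C1psi.
have [_ cpsi'] := C1psi.
have cramp n : continuous (@ramp R n.+1) by have [/C1_continuous] := @C1_ramp R n.+1.
have cdr n : continuous (derive1 (@ramp R n.+1)) by have [[]] := @C1_ramp R n.+1.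
pose chi n t := psi t * ramp n.+1 t.
have chi' n : derive1 (chi n) = fun t =>
    psi t * derive1 (ramp n.+1) t + ramp n.+1 t * derive1 psi t.
  by have [Cr _] := @C1_ramp R n.+1; have [_] := C1_mul C1psi Cr.
have tchi n : test_function T (chi n).
  have [Cr _] := @C1_ramp R n.+1; have [[dchi cchi'] _] := C1_mul C1psi Cr.
  split=> //; exists n.+1%:R^-1, (b1 - a); split.
  - by rewrite invr_gt0.
  - by rewrite ltrBlDr (lt_le_trans b1T)// lerDl.
  - move=> t; apply: contraNT; rewrite negb_and -!ltNge /chi => /orP[tn|tn].
      by rewrite [ramp _ _]ramp0 ?mulr0// mulrC -ler_pdivlMr ?mul1r ?ltW.
    by rewrite /psi phiT ?mul0r// mul1r -ltrBlDr.
have ramp_lim (v : L2 T) (eta : R -> R) : continuous eta ->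
    pairing v (fun t => eta t * ramp n.+1 t) @[n --> \oo] --> pairing v eta.
  move=> ceta; have [C C0 etaC] := continuous_bounded_itv T ceta.
  apply: (@integral_multiplier_cvg _ _ (repr v) (fun n t => eta t * ramp n.+1 t) eta C).
  - by move=> n t; apply: cvgM; [exact: ceta|exact: cramp].
  - exact: continuous_measurable_fun.
  - move=> n t tT; rewrite normrM -[leRHS]mulr1 ler_pM//; first exact: etaC.
    exact: cutoff_norm_le1.
  - move=> t; rewrite in_itv/= => /andP[t0 _]; rewrite -[X in _ --> X]mulr1.
    by apply: cvgMr; rewrite (cvg_shiftS (fun n => ramp n t)); exact: ramp_cvg1.
have lim1 := pairing_ramp_cvg0 u0 cpsi.
have lim2 := ramp_lim u _ cpsi'.
have lim12 : pairing u (fun t => psi t * derive1 (ramp n.+1) t) +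
    pairing u (fun t => derive1 psi t * ramp n.+1 t) @[n --> \oo] -->
    0 + pairing u (derive1 psi) by apply: cvgD.
have lim3 : - pairing g (chi n) @[n --> \oo] --> - pairing g psi.
  by apply: cvgN; exact: ramp_lim.
rewrite -[LHS]add0r -(cvg_lim (@Rhausdorff R) lim12); apply/cvg_lim => //.
apply: cvg_trans lim3; apply: near_eq_cvg; apply: nearW => n /=.
have <- : pairing u (derive1 (chi n)) = - pairing g (chi n) by exact: ug (tchi n).
rewrite chi' pairingDr.
- congr (_ + _).
  by congr (pairing u _); apply/funext => t; rewrite mulrC.
- by move=> t; apply: cvgM; [exact: cpsi|exact: cdr].
- by move=> t; apply: cvgM; [exact: cramp|exact: cpsi'].
Unshelve. all: by end_near. Qed.

Lemma vanishes_at_0_delay (a : R) (u : L2 T) : 0 <= a ->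
  vanishes_at_0 u -> vanishes_at_0 (delay a u).
Proof.
move=> a0 [f [cf uf f0]].
pose g t := f (Num.max (t - a) 0); exists g; split.
- pose m (t : R) := Num.max (t - a) 0.
  have mT t : `[0, T]%classic t -> `[0, T]%classic (m t).
    rewrite /m /= !in_itv/= le_max lexx orbT/= ge_max => /andP[t0 tT].
    by apply/andP; split; lra.
  have cm : continuous m.
    move=> t; apply: (@continuous_comp _ _ _ (fun t => t - a) (fun x => Num.max x 0)).
      by apply: cvgB; [exact: cvg_id|exact: cvg_cst].
    exact: max0_continuous.
  have /subspace_continuousP f_cvg := cf.
  apply/subspace_continuousP => x xT.
  apply: (@cvg_comp _ _ _ m f _ (within `[0, T] (nbhs (m x)))); last first.
    exact: f_cvg (mT _ xT).
  move=> P; rewrite /= !nbhs_simpl/= => mP.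
  have := cm x _ mP; rewrite /= !nbhs_simpl/=.
  by apply: filterS => t /= Pt tT; apply: Pt; exact: mT.
- apply: (ae_eq_trans (repr_pi _)).
  apply: (ae_eq_trans (delay_fun_ae a uf)).
  apply: ae_eq_leb0T => t; rewrite in_itv/= => /andP[t0 tT].
  rewrite /delay_fun patchE /g mem_setE in_itv/=.
  case: (ltP 0 (t - a)) => ta /=; last by rewrite f0.
  by rewrite ifT//; lra.
- by rewrite /g max_r// sub0r oppr_le0.
Qed.

Lemma vanishes_at_0_linear (a : R) (u v : L2 T) :
  vanishes_at_0 u -> vanishes_at_0 v -> vanishes_at_0 (a *: u + v).
Proof.
move=> [f [cf uf f0]] [g [cg vg g0]].
exists (fun t => a * f t + g t); split.
- move=> x; apply: cvgD; last exact: cg.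
  by apply: cvgMr; exact: cf.
- have -> : a *: u + v = \pi_(L2 T)%qT (a *: repr u + repr v).
    by rewrite -L2addE -L2scale_pi !reprK.
  apply: (ae_eq_trans (repr_pi _)).
  apply: (@filterS2 _ _ (ae_filter_ringOfSetsType nu)) uf vg => t uft vgt _.
  by rewrite -(uft I) -(vgt I).
- by rewrite f0 g0 mulr0 addr0.
Qed.

End delay_H1.

(** * Operators on the space-time boundary *)

Section boundary_operators.
Context {R : realType}.
Variable T : R.
Implicit Types (u : L2 T) (v : L2Sigma T).

Lemma H1_0_linear (a : R) u w : H1_0 u -> H1_0 w ->
  H1_0 (a *: u + w) /\ weak_deriv (a *: u + w) = a *: weak_deriv u + weak_deriv w.
Proof.
move=> [[g ug] u0] [[h wh] w0]; have ugwh := is_weak_deriv_linear a ug wh.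
rewrite (weak_derivP ug) (weak_derivP wh) (weak_derivP ugwh).
by split=> //; split; [exists (a *: g + h)|exact: vanishes_at_0_linear].
Qed.

Lemma H1_0_0 : H1_0 (0 : L2 T) /\ weak_deriv (0 : L2 T) = 0.
Proof.
have pairing0 phi : continuous phi -> pairing (0 : L2 T) phi = 0.
  move=> cphi; rewrite -[0 in LHS](addNr (0 : L2 T)) -scaleN1r pairing_linear//.
  by rewrite mulN1r addNr.
have d0 : is_weak_deriv (0 : L2 T) 0.
  move=> phi tphi; have [_ cphi' _] := tphi.
  have cphi := C1_continuous (test_function_C1 tphi).
  by rewrite -/(pairing _ _) -/(pairing 0 phi) !pairing0// oppr0.
rewrite (weak_derivP d0); split=> //; split; first by exists 0.
exists (cst 0); split=> //; first by move=> ?; exact: cst_continuous.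
by rewrite -L2_pi0; exact: repr_pi.
Qed.

Lemma H1_0_delay (a : R) u : 0 <= a -> H1_0 u ->
  H1_0 (delay a u) /\ weak_deriv (delay a u) = delay a (weak_deriv u).
Proof.
move=> a0 [[g ug] u0]; have dug := is_weak_deriv_delay a0 ug u0.
rewrite (weak_derivP ug) (weak_derivP dug).
by split=> //; split; [exists (delay a g)|exact: vanishes_at_0_delay].
Qed.

Lemma sqr_L2Sigma_norm v : L2Sigma_norm v ^+ 2 = L2norm v.1 ^+ 2 + L2norm v.2 ^+ 2.
Proof. by rewrite sqr_sqrtr// addr_ge0 ?sqr_ge0. Qed.

Lemma L2Sigma_normZ (a : R) v :
  L2Sigma_norm (a *: v : L2Sigma T) ^+ 2 = a ^+ 2 * L2Sigma_norm v ^+ 2.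
Proof.
by rewrite !sqr_L2Sigma_norm !L2normZ !exprMn real_normK ?num_real// mulrDr.
Qed.

Lemma L2Sigma_normD v w : L2Sigma_norm (v + w : L2Sigma T) ^+ 2 <=
  2 * (L2Sigma_norm v ^+ 2 + L2Sigma_norm w ^+ 2).
Proof.
rewrite !sqr_L2Sigma_norm/=.
have sqD u1 u2 : L2norm (u1 + u2 : L2 T) ^+ 2 <= 2 * (L2norm u1 ^+ 2 + L2norm u2 ^+ 2).
  apply: (@le_trans _ _ ((L2norm u1 + L2norm u2) ^+ 2)).
    by apply: lerXn2r; rewrite ?nnegrE ?addr_ge0 ?L2norm_ge0 ?ler_L2normD.
  have := sqr_ge0 (L2norm u1 - L2norm u2); nra.
have := sqD v.1 w.1; have := sqD v.2 w.2; lra.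
Qed.

Lemma quadratic_seminorm_L2Sigma :
  quadratic_seminorm (setT : set (L2Sigma T)) (@L2Sigma_norm R T).
Proof.
split=> //.
  by move=> a v _; split=> //; exact: L2Sigma_normZ.
by move=> v w _ _; split=> //; exact: L2Sigma_normD.
Qed.

Lemma quadratic_seminorm_H1_0Sigma :
  quadratic_seminorm (@H1_0Sigma R T) (@H1_0Sigma_norm R T).
Proof.
have [H0 d0] := H1_0_0; split=> //.
- move=> a [v1 v2] [/= H1 H2].
  have := H1_0_linear a H1 H0; have := H1_0_linear a H2 H0.
  rewrite !addr0 d0 !addr0 => -[aH2 a2] [aH1 a1]; split=> //.
  by rewrite /H1_0Sigma_norm /= a1 a2; exact: (L2Sigma_normZ a (_, _)).
- move=> [v1 v2] [w1 w2] [/= Hv1 Hv2] [/= Hw1 Hw2].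
  have := H1_0_linear 1 Hv1 Hw1; have := H1_0_linear 1 Hv2 Hw2.
  rewrite !scale1r => -[H2 d2] [H1 d1]; split=> //.
  by rewrite /H1_0Sigma_norm /= d1 d2; exact: (L2Sigma_normD (_, _) (_, _)).
Qed.

Variable L : R.
Hypothesis L_gt0 : 0 < L.

(** This is [-2 K], with [K] the double layer operator. *)
Definition cross_delay v : L2Sigma T := (delay L v.2, delay L v.1).

Lemma cross_delay_linear : linear cross_delay.
Proof. by move=> a u v; congr (_, _); exact: delay_linear. Qed.

Lemma L2Sigma_norm_cross_delay v :
  L2Sigma_norm (cross_delay v) ^+ 2 <= L2Sigma_norm v ^+ 2.
Proof.
rewrite !sqr_L2Sigma_norm/= addrC.
by apply: lerD; apply: lerXn2r; rewrite ?nnegrE ?L2norm_ge0 ?L2norm_delay.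
Qed.

Lemma bounded_cross_delay_L2Sigma : bounded_sq setT (@L2Sigma_norm R T) cross_delay.
Proof.
by exists 1 => // v _; split=> //; rewrite mul1r; exact: L2Sigma_norm_cross_delay.
Qed.

Lemma bounded_cross_delay_H1_0Sigma :
  bounded_sq (@H1_0Sigma R T) (@H1_0Sigma_norm R T) cross_delay.
Proof.
exists 1 => // -[v1 v2] [/= H1 H2]; rewrite mul1r.
have [Hd1 d1] := H1_0_delay (ltW L_gt0) H1.
have [Hd2 d2] := H1_0_delay (ltW L_gt0) H2.
split=> //; rewrite /H1_0Sigma_norm /= d1 d2.
exact: (L2Sigma_norm_cross_delay (_, _)).
Qed.

(** Every application adds one delay [L] to both components; the swaps and the
    factors [e] are absorbed in [w]. *)
Lemma iter_cross_delay (e : R) (n : nat) v : exists w : L2Sigma T,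
  iter n.+1 (fun w => e *: cross_delay w) v =
  (delay (n.+1%:R * L) w.1, delay (n.+1%:R * L) w.2).
Proof.
have dZ a u : e *: delay a u = delay a (e *: u).
  have delay0 : delay a (0 : L2 T) = 0.
    by have := delay_linear a (-1) (0 : L2 T) 0; rewrite scaler0 addr0 scaleN1r addNr.
  by have := delay_linear a e u 0; rewrite delay0 !addr0.
elim: n => [|n [w IHn]].
  by exists (e *: v.2, e *: v.1); rewrite mul1r/= -!dZ.
exists (e *: w.2, e *: w.1); rewrite iterS IHn -!dZ /cross_delay/=.
have LnL : L + n.+1%:R * L = n.+2%:R * L by rewrite -[n.+2%:R]natr1 mulrDl mul1r addrC.
have nL0 : 0 <= n.+1%:R * L by rewrite mulr_ge0// ltW.
by rewrite !delay_delay ?(ltW L_gt0)// LnL.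
Qed.

Lemma cross_delay_nilpotent (e : R) : exists n,
  iter n (fun w => e *: cross_delay w) =1 cst 0.
Proof.
exists (Num.truncn (T / L)).+1 => v; have [w ->] := iter_cross_delay e (Num.truncn (T / L)) v.
have TL : T <= (Num.truncn (T / L)).+1%:R * L.
  by rewrite -ler_pdivrMr//; apply/ltW/real_truncnS_gt/num_real.
by rewrite !delay_ge.
Qed.

Lemma isomorphism_cross_delay (c e : R) (A : L2Sigma T -> L2Sigma T) : c != 0 ->
  (forall v, A v = c *: (v - e *: cross_delay v)) ->
  continuous_on (@H12Sigma R T) (@H12Sigma_norm R T) A /\
  isomorphism_on (@H12Sigma R T) (@H12Sigma_norm R T) A.
Proof.
move=> c0 AE; have [n Qn] := cross_delay_nilpotent e.
have semiX := quadratic_seminorm_H1_0Sigma; have semiY := quadratic_seminorm_L2Sigma.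
apply: (interp_isomorphism_nilpotent semiX semiY c0 _ _ _ Qn AE).
- move=> a u v; rewrite cross_delay_linear scalerDr; congr (_ + _).
  by rewrite !scalerA mulrC.
- exact: (bounded_sqZ semiX e bounded_cross_delay_H1_0Sigma).
- exact: (bounded_sqZ semiY e bounded_cross_delay_L2Sigma).
Qed.

End boundary_operators.

(** * The boundary integral operators *)

Theorem theorem3p4 (R : realType) (L T : R) (L_gt0 : 0 < L) (T_gt0 : 0 < T) :
  let E := @H12Sigma R T in
  let N := @H12Sigma_norm R T in
  let Aplus := fun v : L2Sigma T => 2^-1 *: v + double_layer L v in
  let Aminus := fun v : L2Sigma T => - 2^-1 *: v + double_layer L v in
  [/\ continuous_on E N Aplus, isomorphism_on E N Aplus,
      continuous_on E N Aminus & isomorphism_on E N Aminus].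
Proof.
move=> E N Aplus Aminus.
have KE v : double_layer L v = - 2^-1 *: cross_delay L v by [].
have AplusE v : Aplus v = 2^-1 *: (v - 1 *: cross_delay L v).
  by rewrite /Aplus KE scale1r scalerBr scaleNr.
have AminusE v : Aminus v = - 2^-1 *: (v - (-1) *: cross_delay L v).
  by rewrite /Aminus KE scaleN1r opprK scalerDr.
have half0 : 2^-1 != 0 :> R by rewrite invr_eq0.
have [cp ip] := isomorphism_cross_delay L_gt0 half0 AplusE.
have mhalf0 : - 2^-1 != 0 :> R by rewrite oppr_eq0.
have [cm im] := isomorphism_cross_delay L_gt0 mhalf0 AminusE.
by split.
Qed.
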